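(* Let $R$ be a subring of $\mathbb Q$ with $R\neq\mathbb Z$. There exists a family $V_x$, for $x\subseteq\mathbb N$, of uncountable Polish $R$-modules such that, for all $x,y\subseteq\mathbb N$: (i) there is a continuous $R$-embedding $V_x\to\mathbb R$; (ii) if $x\setminus y$ is finite, then there is a continuous $R$-embedding $V_x\to V_y$; (iii) if $x\setminus y$ is infinite, then every continuous $R$-module homomorphism $V_x\to V_y$ is identically equal to $0$; in particular there is no continuous $R$-embedding $V_x\to V_y$. Moreover, there exist continuous $R$-embeddings $f_x\colon V_x\to\mathbb R$ ($x\subseteq\mathbb N$) witnessing (i) such that, whenever $x\setminus y$ is finite, (ii) is witnessed by a continuous $R$-embedding $g\colon V_x\to V_y$ with $f_x=f_y\circ g$; and the image $f_x(V_x)$ is a countable union of closed subsets of $\mathbb R$.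
   Context: $\mathbb N=\{1,2,3,\dots\}$. $\mathbb R$ is regarded as a $\mathbb Q$-vector space (hence an $R$-module for any subring $R\subseteq\mathbb Q$). For a countable commutative ring $R$ with unity, a Polish $R$-module is an abelian Polish group $(M,+)$ together with a map $R\times M\to M$, $(r,m)\mapsto r\cdot m$, continuous when $R$ carries the discrete topology, satisfying $r(m_1+m_2)=rm_1+rm_2$, $(r_1+r_2)m=r_1m+r_2m$, $r_1(r_2m)=(r_1r_2)m$, $1m=m$. An $R$-module homomorphism is a group homomorphism $f$ with $f(rm)=rf(m)$; an $R$-embedding is an injective $R$-module homomorphism. *)

(* Defs.v *)
From HB Require Import structures.
From mathcomp Require Import all_boot all_order all_algebra.
From mathcomp Require Import all_classical all_reals all_analysis.
Set Implicit Arguments.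
Unset Strict Implicit.
Unset Printing Implicit Defensive.
Import Order.TTheory GRing.Theory Num.Theory.
Import numFieldNormedType.Exports.
Local Open Scope classical_set_scope.
Local Open Scope ring_scope.

Definition is_distance (K : realType) (T : Type) (d : T -> T -> K) : Prop :=
  [/\ forall x y, 0 <= d x y,
      forall x y, d x y = 0 <-> x = y,
      forall x y, d x y = d y x
    & forall x y z, d x z <= d x y + d y z].

Definition separable_space (T : topologicalType) : Prop :=
  exists2 D : set T, countable D & dense D.

Definition completely_metrizable (K : realType) (T : topologicalType) : Prop :=
  exists d : T -> T -> K,
    [/\ is_distance d,
        forall x, nbhs x = nbhs_ball_ (fun y e => [set z | d y z < e]) x
      & forall u : nat -> T,
          (forall e : K, 0 < e ->
             exists N, forall m n, (N <= m)%N -> (N <= n)%N -> d (u m) (u n) < e) ->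
          exists l : T, u @ \oo --> l].

Definition polish_space (K : realType) (T : topologicalType) : Prop :=
  separable_space T /\ completely_metrizable K T.

(* [K] is the copy of the real numbers in which distances take their values. *)
Record polishModule (K : realType) (R : comPzRingType) := PolishModule {
  polish_group : topologicalZmodType ;
  polish_scale : R -> polish_group -> polish_group ;
  polish_scaleDr : forall r m1 m2,
    polish_scale r (m1 + m2) = polish_scale r m1 + polish_scale r m2 ;
  polish_scaleDl : forall r1 r2 m,
    polish_scale (r1 + r2) m = polish_scale r1 m + polish_scale r2 m ;
  polish_scaleA : forall r1 r2 m,
    polish_scale r1 (polish_scale r2 m) = polish_scale (r1 * r2) m ;
  polish_scale1 : forall m, polish_scale 1 m = m ;
  polish_scale_continuous :
    continuous (fun z : discrete_topology R * polish_group =>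
                  polish_scale z.1 z.2) ;
  polish_groupP : polish_space K polish_group
}.

(* The library joins topologies and [lmodType] structures only over a
   [numDomainType] of scalars carrying its order topology, hence the separate
   instances on the carrier. *)
Definition polish_sort (K : realType) (R : comPzRingType)
  (M : polishModule K R) : Type := polish_group M.
Coercion polish_sort : polishModule >-> Sortclass.

HB.instance Definition _ (K : realType) (R : comPzRingType)
    (M : polishModule K R) :=
  TopologicalZmodule.copy (polish_sort M) (polish_group M).

HB.instance Definition _ (K : realType) (R : comPzRingType)
    (M : polishModule K R) :=
  GRing.Zmodule_isLmodule.Build R (polish_sort M)
    (@polish_scaleA K R M) (@polish_scale1 K R M)
    (@polish_scaleDr K R M) (fun m r1 r2 => @polish_scaleDl K R M r1 r2 m).

Section RealModule.
Variables (K : realType) (A : {pred rat}) (R : subComPzRingType A).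

Definition real_scale (r : R) (x : K^o) : K^o := ratr (val r) * x.

Lemma real_scaleDr r x y :
  real_scale r (x + y) = real_scale r x + real_scale r y.
Proof. exact: mulrDr. Qed.

Lemma real_scaleDl r s x :
  real_scale (r + s) x = real_scale r x + real_scale s x.
Proof. by rewrite /real_scale !rmorphD mulrDl. Qed.

Lemma real_scaleA r s x :
  real_scale r (real_scale s x) = real_scale (r * s) x.
Proof. by rewrite /real_scale !rmorphM mulrA. Qed.

Lemma real_scale1 x : real_scale 1 x = x.
Proof. by rewrite /real_scale !rmorph1 mul1r. Qed.

Lemma real_scale_continuous :
  continuous (fun z : discrete_topology R * K^o => real_scale z.1 z.2).
Proof.
move=> [r x] /= U nU.
have h : {for x, continuous (fun y : K => ratr (val r) * y)}.
  exact: mulrl_continuous.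
have nV : nbhs x [set y : K | U (ratr (val r) * y)] by exact: h.
exists ([set r], [set y : K | U (ratr (val r) * y)]) => /=.
  by split => //; exact/principal_filterP.
by move=> [s y] /= [-> ].
Qed.

Lemma real_polish_space : polish_space K K^o.
Proof.
split.
  exists (range (@ratr K : rat -> K)); last exact: dense_rat.
  exact: sub_countable (card_image_le _ _) (countableP _).
exists (fun x y : K => `|x - y|); split.
- split => //.
  + move=> x y; split=> [/normr0_eq0 /eqP|->]; last by rewrite subrr normr0.
    by rewrite subr_eq0 => /eqP.
  + by move=> x y; rewrite distrC.
  + move=> x y z; rewrite (le_trans _ (ler_normD _ _))// addrA subrK//.
- by move=> x; rewrite -nbhs_ballE.
- move=> u uc; suff : cvg ((u : nat -> K) @ \oo) by move=> /cvg_ex.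
  apply/cauchy_cvgP/cauchy_ballP => e e0.
  rewrite near_map2; have [N hN] := uc e e0.
  exists ([set n | (N <= n)%N], [set n | (N <= n)%N]) => /=.
    by split; exists N.
  by move=> [m n] /= [? ?]; exact: hN.
Qed.

Definition real_module : polishModule K R :=
  PolishModule real_scaleDr real_scaleDl real_scaleA real_scale1
    real_scale_continuous real_polish_space.

End RealModule.

(* Main.v *)
(* Fix p >= 2 invertible in R, and a chain of lattices (1/b_n)Z, with b_n a unit
   of R, such that b_n grows at most exponentially and every t invertible in R
   satisfies t b_n | b_(n+w) for some w and all n.  Given a set X of scales, let
   V_X be the group of reals v of finite norm
     N_X(v) = |v| + sum over j not in X of
                b_(n_j) sum_(m <= n_j) C^(m - n_j) dist(v, (1/b_m)Z),   n_j = 4^j,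
   for a large constant C.  Each summand is continuous, so N_X is lower
   semicontinuous: V_X is complete and a countable union of closed sets.  Passing
   from v to v/t shifts the lattices by w, at the bounded cost C^w, so V_X is an
   R-module, and R is dense in it because subtracting from v its nearest point in
   some (1/b_M)Z increases none of the distances.  Each single scale is bounded by
   a multiple of |v|, so only X modulo finite sets matters.  Finally 1/b_(n_k) is
   N_X-small when k is in X, whereas N_Y(c/b_(n_k)) >= const(c) > 0 when k is not
   in Y.  A continuous homomorphism V_X -> V_Y is multiplication by a real c, as R
   is dense; so c = 0 if X \ Y is infinite. *)
From HB Require Import structures.
Require Import Defs.
From mathcomp Require Import all_boot all_order all_algebra.
From mathcomp Require Import all_classical all_reals all_analysis.
From mathcomp Require Import borel_hierarchy.
From mathcomp Require Import ring lra zify.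
Set Implicit Arguments.
Unset Strict Implicit.
Unset Printing Implicit Defensive.
Import Order.TTheory GRing.Theory Num.Theory.
Import numFieldNormedType.Exports.
Local Open Scope classical_set_scope.
Local Open Scope ring_scope.

(** * Polish modules from lower semicontinuous norms *)

(* A sequence of continuous group norms on the line, standing for the lower
   semicontinuous norm [sup_n F n v] with values in [0, +oo]. *)
Record lscNorm (K : realType) (A : {pred rat}) (R : subComPzRingType A) :=
LscNorm {
  lscnorm_fun :> nat -> K -> K ;
  lscnormN : forall n v, lscnorm_fun n (- v) = lscnorm_fun n v ;
  lscnormD : forall n u v,
    lscnorm_fun n (u + v) <= lscnorm_fun n u + lscnorm_fun n v ;
  normr_le_lscnorm : forall n v, `|v| <= lscnorm_fun n v ;
  lscnorm_lipschitz : forall n, exists2 L : K, 0 < L &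
    forall v, lscnorm_fun n v <= L * `|v| ;
  lscnorm_scale : forall r : R, exists2 c : K, 0 < c &
    forall n v, lscnorm_fun n (ratr (val r) * v) <= c * lscnorm_fun n v ;
  lscnorm_dense : forall v C, (forall n, lscnorm_fun n v <= C) ->
    forall e : K, 0 < e ->
    exists r : R, forall n, lscnorm_fun n (v - ratr (val r)) <= e
}.

Section FiniteNorm.
Context (K : realType) (A : {pred rat}) (R : subComPzRingType A).
Variable F : @lscNorm K A R.
Implicit Types (u v w : K).

Lemma lscnorm_ge0 n v : 0 <= F n v.
Proof. exact: le_trans (normr_ge0 v) (normr_le_lscnorm F n v). Qed.

Lemma lscnorm0 n : F n 0 = 0.
Proof.
have [L _ /(_ 0)] := lscnorm_lipschitz F n.
by rewrite normr0 mulr0 => h; apply/eqP; rewrite eq_le h lscnorm_ge0.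
Qed.

Lemma lscnormB n u v : F n (u - v) <= F n u + F n v.
Proof. by rewrite -[F n v]lscnormN; exact: lscnormD. Qed.

Lemma lscnorm_continuous n : continuous (F n : K -> K).
Proof.
have [L L0 hL] := lscnorm_lipschitz F n.
move=> v; apply/cvgrPdist_le => /= e e0; near=> w.
have h : `|v - w| <= e / L.
  near: w; apply: cvgr_dist_le; [exact: cvg_id | exact: divr_gt0].
have h1 : F n (v - w) <= e.
  by apply: le_trans (hL _) _; rewrite mulrC -ler_pdivlMr.
have h2 : F n v <= F n (v - w) + F n w by rewrite -{1}(subrK w v) lscnormD.
have h3 : F n w <= F n (v - w) + F n v.
  by rewrite -[F n (v - w)]lscnormN opprB -{1}(subrK v w) lscnormD.
by rewrite ler_norml; lra.
Unshelve. all: by end_near. Qed.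

(** This is lower semicontinuity of [sup_n F n]; it gives completeness and the countable union of
    closed sets. *)
Lemma lscnorm_closed_ball C : closed [set v | forall n, F n v <= C].
Proof.
rewrite (_ : mkset _ = \bigcap_n (F n @^-1` [set t : K | t <= C])).
  apply: closed_bigI => n _.
  by apply: closed_comp (@closed_le _ C) => x _; exact: lscnorm_continuous.
by apply/seteqP; split=> v h => [n _|n]; exact: h.
Qed.

Definition finite_norm : {pred K} := fun v => `[< exists C, forall n, F n v <= C >].

Lemma finite_normP v : reflect (exists C, forall n, F n v <= C) (v \in finite_norm).
Proof. exact: asboolP. Qed.

Fact finite_norm_zmod_closed : zmod_closed finite_norm.
Proof.
split; first by apply/finite_normP; exists 0 => n; rewrite lscnorm0.
move=> u v /finite_normP[a ha] /finite_normP[b hb].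
apply/finite_normP; exists (a + b) => n.
exact: le_trans (lscnormB _ _ _) (lerD (ha n) (hb n)).
Qed.

HB.instance Definition _ :=
  GRing.isZmodClosed.Build K finite_norm finite_norm_zmod_closed.

Record normable := Normable { normable_val : K ; _ : normable_val \in finite_norm }.

HB.instance Definition _ := [isSub for normable_val].
HB.instance Definition _ := [Choice of normable by <:].
HB.instance Definition _ := [SubChoice_isSubZmodule of normable by <:].

(** Meaningful on [finite_norm] only: elsewhere [sup] is taken of an unbounded set and returns a
    default value. *)
Definition lsc_sup v := sup (range (F^~ v)).

Lemma lsc_sup_le v C : (forall n, F n v <= C) -> lsc_sup v <= C.
Proof.
move=> h; apply: ge_sup; first by exists (F 0%N v), 0%N.
by move=> _ [n _ <-].
Qed.

Lemma lsc_sup_ge v n : v \in finite_norm -> F n v <= lsc_sup v.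
Proof.
move=> /finite_normP[C hC]; apply: ub_le_sup; last by exists n.
by exists C => _ [m _ <-].
Qed.

Implicit Types x y z : normable.

Definition ndist x y := lsc_sup (val (x - y)).

Lemma ndist_ge x y n : F n (val x - val y) <= ndist x y.
Proof. by rewrite -raddfB; apply: lsc_sup_ge; exact: valP. Qed.

Lemma ndist_le x y C : (forall n, F n (val x - val y) <= C) -> ndist x y <= C.
Proof. by move=> h; apply: lsc_sup_le => n; rewrite raddfB. Qed.

Lemma ndist_ge_norm x y : `|val x - val y| <= ndist x y.
Proof. exact: le_trans (normr_le_lscnorm F 0 _) (ndist_ge _ _ _). Qed.

Lemma ndist_distance : is_distance ndist.
Proof.
have sym x y : ndist x y <= ndist y x.
  by apply: ndist_le => n; rewrite -lscnormN opprB ndist_ge.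
split.
- by move=> x y; exact: le_trans (normr_ge0 _) (ndist_ge_norm _ _).
- move=> x y; split => [h|->].
    apply/val_inj/eqP; rewrite -subr_eq0 -normr_le0 -h; exact: ndist_ge_norm.
  apply/eqP; rewrite eq_le (le_trans (normr_ge0 _) (ndist_ge_norm _ _)) andbT.
  by apply: ndist_le => n; rewrite subrr lscnorm0.
- by move=> x y; apply/eqP; rewrite eq_le !sym.
- move=> x y z; apply: ndist_le => n.
  rewrite -(subrK (val y) (val x)) -addrA.
  by apply: le_trans (lscnormD _ _ _ _) _; rewrite lerD // ndist_ge.
Qed.

Lemma ndist_xx x : ndist x x = 0.
Proof. by case: ndist_distance => _ /(_ x x)[_ ->]. Qed.

Lemma ndist_triangle y x z : ndist x z <= ndist x y + ndist y z.
Proof. by case: ndist_distance. Qed.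

HB.instance Definition _ := hasNbhs.Build normable
  (nbhs_ball_ (fun x e => [set y | ndist x y < e])).

Lemma nbhs_normableP x (U : set normable) :
  nbhs x U <-> exists2 e : K, 0 < e & forall y, ndist x y < e -> U y.
Proof. by []. Qed.

Fact nbhs_normable_filter x : ProperFilter (nbhs x).
Proof.
apply: Build_ProperFilter_ex.
  by move=> U /nbhs_normableP[e e0 h]; exists x; apply: h; rewrite ndist_xx.
split.
- by apply/nbhs_normableP; exists 1.
- move=> U V /nbhs_normableP[a a0 ha] /nbhs_normableP[b b0 hb].
  apply/nbhs_normableP; exists (Order.min a b); first by rewrite lt_min a0.
  by move=> y; rewrite lt_min => /andP[? ?]; split; [exact: ha | exact: hb].
- move=> U V UV /nbhs_normableP[a a0 ha].
  by apply/nbhs_normableP; exists a => // y /ha /UV.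
Qed.

Fact nbhs_normable_singleton x (U : set normable) : nbhs x U -> U x.
Proof. by move=> /nbhs_normableP[e e0 h]; apply: h; rewrite ndist_xx. Qed.

Fact nbhs_normable_nbhs x (U : set normable) : nbhs x U -> nbhs x (nbhs^~ U).
Proof.
move=> /nbhs_normableP[e e0 h]; apply/nbhs_normableP; exists (e / 2).
  by rewrite divr_gt0.
move=> y xy; apply/nbhs_normableP; exists (e / 2); first by rewrite divr_gt0.
move=> z yz; apply: h; apply: le_lt_trans (ndist_triangle y _ _) _.
by rewrite [e]splitr ltrD.
Qed.

HB.instance Definition _ := Nbhs_isNbhsTopological.Build normable
  nbhs_normable_filter nbhs_normable_singleton nbhs_normable_nbhs.

Fact normable_sub_continuous : continuous (fun z : normable * normable => z.1 - z.2).
Proof.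
move=> [x y] U /nbhs_normableP[e e0 h].
exists ([set x' | ndist x x' < e / 2], [set y' | ndist y y' < e / 2]) => /=.
  by split; apply/nbhs_normableP; exists (e / 2) => //; rewrite divr_gt0.
move=> [x' y'] /= [hx hy]; apply: h => /=.
suff : ndist (x - y) (x' - y') <= ndist x x' + ndist y y'.
  by move/le_lt_trans; apply; rewrite [e]splitr ltrD.
apply: ndist_le => n; rewrite !(raddfB val) /=.
rewrite (_ : _ - _ = (val x - val x') - (val y - val y')); last by rewrite /=; ring.
by apply: le_trans (lscnormB _ _ _) _; rewrite lerD // ndist_ge.
Qed.

HB.instance Definition _ :=
  PreTopologicalNmodule_isTopologicalZmodule.Build normable normable_sub_continuous.

Fact finite_norm_scale (r : R) v :
  v \in finite_norm -> ratr (val r) * v \in finite_norm.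
Proof.
move=> /finite_normP[C hC]; have [c c0 hc] := lscnorm_scale F r.
apply/finite_normP; exists (c * C) => n.
by apply: le_trans (hc _ _) _; rewrite ler_pM2l.
Qed.

Definition normable_scale (r : R) x : normable :=
  Normable (finite_norm_scale r (valP x)).

Fact normable_scaleDr r x y :
  normable_scale r (x + y) = normable_scale r x + normable_scale r y.
Proof. by apply: val_inj; rewrite [RHS](raddfD val) /= -mulrDr. Qed.

Fact normable_scaleDl r s x :
  normable_scale (r + s) x = normable_scale r x + normable_scale s x.
Proof. by apply: val_inj; rewrite [RHS](raddfD val) /= !rmorphD mulrDl. Qed.

Fact normable_scaleA r s x :
  normable_scale r (normable_scale s x) = normable_scale (r * s) x.
Proof. by apply: val_inj; rewrite /= !rmorphM mulrA. Qed.

Fact normable_scale1 x : normable_scale 1 x = x.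
Proof. by apply: val_inj; rewrite /= !rmorph1 mul1r. Qed.

Fact normable_scale_continuous :
  continuous (fun z : discrete_topology R * normable => normable_scale z.1 z.2).
Proof.
move=> [r x] /= U /nbhs_normableP[e e0 h].
have [c c0 hc] := lscnorm_scale F r.
exists ([set r], [set y | ndist x y < e / c]) => /=.
  split; first exact/principal_filterP.
  by apply/nbhs_normableP; exists (e / c) => //; rewrite divr_gt0.
move=> [s y] /= [-> xy]; apply: h.
apply: le_lt_trans (_ : c * ndist x y < _); last by rewrite mulrC -ltr_pdivlMr.
apply: ndist_le => n; rewrite /= -mulrBr.
by apply: le_trans (hc _ _) _; rewrite ler_pM2l // ndist_ge.
Qed.

Lemma normable_dense x (e : K) : 0 < e ->
  exists y r, val y = ratr (val (r : R)) /\ ndist x y < e.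
Proof.
move=> e0; have /finite_normP[C hC] := valP x.
have [r hr] := lscnorm_dense hC (divr_gt0 e0 (ltr0n _ 2)).
have rF : ratr (val r) \in finite_norm.
  apply/finite_normP; exists (C + e / 2) => n.
  rewrite -[ratr _](subKr (val x)).
  by apply: le_trans (lscnormB _ _ _) _; rewrite lerD.
exists (Normable rF), r; split => //.
apply: le_lt_trans (_ : e / 2 < e); last by lra.
by apply: ndist_le => n; exact: hr.
Qed.

Lemma normable_polish : polish_space K normable.
Proof.
split.
  (* [insubd] sends the rationals outside the module to 0, so this countable set contains every
     element of [R] that lies in the module. *)
  exists (range (fun q : rat => insubd (0 : normable) (ratr q))).
    exact: sub_countable (card_image_le _ _) (countableP _).
  move=> U [x Ux] oU.
  have /nbhs_normableP[e e0 h] : nbhs x U by apply: open_nbhs_nbhs; split.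
  have [y [r [yr xy]]] := normable_dense x e0.
  exists y; split; [exact: h | exists (val r) => //].
  by apply: val_inj; rewrite insubdK -yr ?(valP y).
exists ndist; split; [exact: ndist_distance | by [] |].
move=> u uc.
have : cvg ((fun n => val (u n) : K) @ \oo).
  apply/cauchy_cvgP/cauchy_ballP => e e0.
  rewrite near_map2; have [N hN] := uc e e0.
  exists ([set n | (N <= n)%N], [set n | (N <= n)%N]) => /=.
    by split; exists N.
  by move=> [m n] /= [? ?]; apply: le_lt_trans (ndist_ge_norm _ _) _; exact: hN.
move=> /cvg_ex[l ul].
(* A Cauchy bound survives the passage to the limit on the line because norm balls are closed
   there. *)
have near_l e : 0 < e -> exists N, forall n, (N <= n)%N ->
    forall k, F k (l - val (u n)) <= e.
  move=> e0; have [N hN] := uc e e0; exists N => n Nn.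
  suff : [set v | forall k, F k v <= e] (l - val (u n)) by [].
  have cv : (fun m => val (u m) - val (u n)) @ \oo --> l - val (u n).
    by apply: cvgB => //; exact: cvg_cst.
  apply: (closed_cvg _ (@lscnorm_closed_ball e) _ _ cv).
  exists N => // m /= Nm k.
  by apply: le_trans (ndist_ge _ _ _) _; apply: ltW; exact: hN.
have lF : l \in finite_norm.
  have [N hN] := near_l 1 ltr01.
  have /finite_normP[C hC] := valP (u N).
  apply/finite_normP; exists (1 + C) => k; rewrite -(subrK (val (u N)) l).
  by apply: le_trans (lscnormD _ _ _ _) _; rewrite lerD // hN.
exists (Normable lF) => U /nbhs_normableP[e e0 h].
have [N hN] := near_l (e / 2) (divr_gt0 e0 (ltr0n _ 2)).
exists N => // n /= Nn; apply: h.
apply: le_lt_trans (_ : e / 2 < e); last by lra.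
by apply: ndist_le => k; exact: hN.
Qed.

Definition normable_module : polishModule K R :=
  PolishModule normable_scaleDr normable_scaleDl normable_scaleA normable_scale1
    normable_scale_continuous normable_polish.

End FiniteNorm.

(** * Inclusion into the line, comparison, rigidity and uncountability *)

Section NormableModuleTheory.
Context (K : realType) (A : {pred rat}) (R : subComPzRingType A).
Implicit Types F G : @lscNorm K A R.

Definition normable_incl F : normable_module F -> real_module K R :=
  fun x => val (x : normable F).

Fact normable_incl_is_linear F : linear (@normable_incl F).
Proof. by move=> r x y. Qed.

HB.instance Definition _ F := GRing.isLinear.Build R (normable_module F)
  (real_module K R) _ (@normable_incl F) (@normable_incl_is_linear F).

Lemma normable_incl_inj F : injective (@normable_incl F).
Proof. by move=> x y h; apply: val_inj. Qed.

Lemma normable_incl_continuous F : continuous (@normable_incl F).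
Proof.
move=> x U /= /(nbhs_ballP (val (x : normable F) : K)) [e e0 h].
exists e => // y xy; apply: h.
exact: le_lt_trans (ndist_ge_norm _ _) xy.
Qed.

Lemma normable_incl_Fsigma F : Fsigma (range (@normable_incl F) : set K).
Proof.
exists (fun i => [set v : K | forall n, F n v <= i%:R]).
  by move=> i; exact: lscnorm_closed_ball.
apply/seteqP; split=> [_ [x _ <-]|v [i _ hi]].
  have /finite_normP[C hC] := valP (x : normable F).
  exists (Num.truncn `|C|).+1 => // n.
  apply: le_trans (hC n) _; apply: le_trans (ler_norm _) _.
  by apply: ltW; rewrite truncnS_gt.
have vF : v \in finite_norm F by apply/finite_normP; exists i%:R.
by exists (Normable vF).
Qed.

Section Comparison.
Variables (F G : @lscNorm K A R) (c : K).
Hypotheses (c0 : 0 < c) (FG : forall n v, G n v <= c * F n v).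

Fact finite_norm_le (x : normable F) : val x \in finite_norm G.
Proof.
have /finite_normP[C hC] := valP x; apply/finite_normP; exists (c * C) => n.
by apply: le_trans (FG _ _) _; rewrite ler_pM2l.
Qed.

Definition normable_le : normable_module F -> normable_module G :=
  fun x => Normable (finite_norm_le x).

Fact normable_le_is_linear : linear normable_le.
Proof. by move=> r x y; apply: val_inj. Qed.

HB.instance Definition _ := GRing.isLinear.Build R (normable_module F)
  (normable_module G) _ normable_le normable_le_is_linear.

Lemma normable_le_embedding :
  exists g : {linear normable_module F -> normable_module G},
    [/\ continuous g, injective g &
        @normable_incl F =1 @normable_incl G \o g].
Proof.
exists normable_le; split => //.
- move=> x U [e e0 h]; exists (e / c); first by rewrite /= divr_gt0.
  move=> y xy; apply: h => /=.
  apply: le_lt_trans (_ : c * ndist x y < _); last by rewrite mulrC -ltr_pdivlMr.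
  apply: ndist_le => n; apply: le_trans (FG _ _) _.
  by rewrite ler_pM2l // ndist_ge.
- by move=> x y /(congr1 val) h; apply: val_inj.
Qed.

End Comparison.

(* [R] is dense in the source, so a continuous linear map is determined by the
   image [c] of 1, and acts as multiplication by [c] on the line. *)
Lemma continuous_linear_eq0 F G :
  (exists C, forall n, F n 1 <= C) ->
  (forall c : K, c != 0 -> exists2 d : K, 0 < d & forall e : K, 0 < e ->
     exists r : R, (forall n, F n (ratr (val r)) <= e) /\
                   exists n, d <= G n (ratr (val r) * c)) ->
  forall g : {linear normable_module F -> normable_module G},
    continuous g -> forall v, g v = 0.
Proof.
move=> /finite_normP F1 FG g gc.
have g0 e : 0 < e -> exists2 d : K, 0 < d &
    forall x : normable F, ndist 0 x < d -> ndist 0 (g x : normable G) < e.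
  move=> e0; have : nbhs (g 0 : normable G) [set y : normable G | ndist 0 y < e].
    by rewrite linear0; exists e.
  by move=> /gc [d d0 h]; exists d.
pose one : normable_module F := Normable F1.
pose c : K := val (g one : normable G).
have gR r : val (g (r *: one) : normable G) = ratr (val r) * c.
  by rewrite linearZ.
have c0 : c = 0.
  apply/eqP/negP => /negP c0; have [d d0 hd] := FG c c0.
  have [e e0 he] := g0 d d0.
  have [r [Fr [n dn]]] := hd (e / 2) (divr_gt0 e0 (ltr0n _ 2)).
  have : ndist 0 (g (r *: one) : normable G) < d.
    apply: he; apply: le_lt_trans (_ : e / 2 < e); last by lra.
    apply: ndist_le => m; rewrite sub0r lscnormN /= mulr1; exact: Fr.
  apply/negP; rewrite -leNgt; apply: le_trans (ndist_ge _ _ n).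
  by rewrite sub0r lscnormN gR.
move=> v; apply: val_inj => /=; apply/eqP; rewrite -normr_le0.
apply/ler_addgt0Pl => e e0; rewrite addr0.
have [d d0 hd] := g0 e e0.
have [y [r [yr vy]]] := normable_dense (v : normable F) d0.
have yE : (y : normable_module F) = r *: one.
  by apply: val_inj; rewrite yr /= mulr1.
have gy : g (y : normable_module F) = 0.
  by apply: val_inj; rewrite yE gR c0 mulr0.
have <- : g (v - y) = g v by rewrite linearB gy subr0.
have : ndist 0 (g (v - y) : normable G) < e.
  apply: hd; apply: le_lt_trans vy; apply: ndist_le => n.
  by rewrite sub0r lscnormN; exact: ndist_ge.
move=> /ltW; apply: le_trans; rewrite -normrN -[X in `|X|]sub0r.
exact: (ndist_ge_norm (0 : normable G) (g (v - y))).
Qed.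

(* Diagonal argument: the [n]-th step of a sum of very short vectors is chosen
   so that the limit avoids the [n]-th element of an enumeration. *)
Lemma normable_uncountable F :
  (forall e : K, 0 < e -> exists2 u : K, 0 < u & forall n, F n u <= e) ->
  ~ countable [set: normable_module F].
Proof.
move=> short /countable_injP[i /in2TT iinj].
(* [e] lists the module along the injection [i]; codes of no element get the value 0. *)
pose e n : K := if pselect (exists x : normable F, i x = n) is left h
  then val (projT1 (cid h)) else 0.
have eE x : e (i x) = val (x : normable F).
  rewrite /e; case: pselect => [h|[]]; last by exists x.
  by congr val; apply: iinj; rewrite (projT2 (cid h)).
have {short} /choice[ch chP] : forall t : K, exists u : K,
    0 < t -> 0 < u /\ forall n, F n u <= t.
  move=> t; case: (ltP 0 t) => [/short[u u0 hu]|]; first by exists u.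
  by exists 0.
pose u := fix u k := if k is k'.+1 then ch (u k' / 4%:R) else ch 1.
(* If [e k] lies in the first half of [[s k, s k + u k]], the step jumps past it; otherwise the
   later steps, of total at most [2 * u k.+1 <= u k / 2], keep the limit inside that half. *)
pose s := fix s k : K := if k is k'.+1 then
  (if s k' <= e k' <= s k' + u k' / 2%:R then s k' + u k' else s k') else 0.
have u0 k : 0 < u k.
  elim: k => [|k IH] /=; first by have [] := chP 1 ltr01.
  by have [] := chP (u k / 4%:R) (divr_gt0 IH (ltr0n _ 4)).
have Fu0 n : F n (u 0%N) <= 1 by have [] := chP 1 ltr01.
have Fu n k : F n (u k.+1) <= u k / 4%:R.
  by have [] := chP (u k / 4%:R) (divr_gt0 (u0 k) (ltr0n _ 4)).
have uS k : u k.+1 <= u k / 4%:R.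
  apply: le_trans (Fu 0%N k); apply: le_trans (normr_le_lscnorm _ _ _).
  exact: ler_norm.
have sS k : s k <= s k.+1 <= s k + u k.
  by rewrite /=; case: ifP => _; have := u0 k; lra.
have FsS n k : F n (s k.+1) <= F n (s k) + F n (u k).
  rewrite /=; case: ifP => _; first exact: lscnormD.
  by rewrite lerDl lscnorm_ge0.
(* The slack [u k] covers both the next step and the next slack, each at most [u k / 4]. *)
have Fs n k : F n (s k.+1) <= 2%:R - u k.
  elim: k => [|k IH].
    apply: le_trans (FsS _ _) _; rewrite lscnorm0 add0r.
    have := Fu0 n; have : u 0%N <= 1; last by lra.
    apply: le_trans (Fu0 0%N); apply: le_trans (normr_le_lscnorm _ _ _).
    exact: ler_norm.
  by apply: le_trans (FsS _ _) _; have := Fu n k; have := uS k; have := u0 k; lra.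
have s_nd : {homo s : m n / (m <= n)%N >-> m <= n}.
  by apply/nondecreasing_seqP => k; case/andP: (sS k).
have s_up k m : (k <= m)%N -> s m + 2%:R * u m <= s k + 2%:R * u k.
  elim: m => [|m IH]; first by rewrite leqn0 => /eqP->.
  rewrite leq_eqVlt => /predU1P[->//|]; rewrite ltnS => /IH.
  by have := uS m; have /andP[_] := sS m; have := u0 m; lra.
have s_cvg : cvgn s.
  apply: nondecreasing_is_cvgn; first exact: s_nd.
  exists (s 0%N + 2%:R * u 0%N) => _ [m _ <-].
  by have := s_up 0%N m (leq0n m); have := u0 m; lra.
pose l := limn s.
have l_ge k : s k <= l by exact: nondecreasing_cvgn_le.
have l_le k : l <= s k + 2%:R * u k.
  apply: limr_le => //; exists k => // m /= km.
  by have := s_up k m km; have := u0 m; lra.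
have lF : l \in finite_norm F.
  apply/finite_normP; exists 2%:R.
  suff : [set v | forall n, F n v <= 2%:R] l by [].
  apply: (closed_cvg _ (@lscnorm_closed_ball _ _ _ F 2%:R) _ _ s_cvg).
  exists 1%N => // -[//|k] _ n.
  by apply: le_trans (Fs n k) _; have := u0 k; lra.
have := eE (Normable lF); set k := i _ => /= ekl.
have := l_ge k.+1; have := l_le k.+1; have := uS k; have := u0 k.
by rewrite -ekl /=; case: ifP; lra.
Qed.

End NormableModuleTheory.

(** * The lattices *)

Section Denominators.
Variables (p : nat) (S : pred nat).
Hypothesis p_gt1 : (1 < p)%N.

(** Integers not in [S] contribute 1, so that products can run over all indices; [S] will be
    invertibility in [R]. *)
Definition denfac j : nat := if S j.+1 then j.+1 else 1.

Definition period j : nat := j.+1 * 2 ^ j.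

(* Dividing by [denfac j] costs only [period j] levels, while the periods grow
   so fast that the growth stays exponential. *)
Definition den n : nat := p ^ n * \prod_(j < n) denfac j ^ (n %/ period j).

Lemma denfac_gt0 j : (0 < denfac j)%N.
Proof. by rewrite /denfac; case: ifP. Qed.

Lemma period_gt j : (j < period j)%N.
Proof. by rewrite /period leq_pmulr // expn_gt0. Qed.

Lemma den_gt0 n : (0 < den n)%N.
Proof.
rewrite muln_gt0 expn_gt0 (ltnW p_gt1) /= prodn_gt0 // => j.
by rewrite expn_gt0 denfac_gt0.
Qed.

(** For [j >= n] the exponent [n %/ period j] is 0, as [period j > j]; all levels up to [m] thus
    share one index range. *)
Lemma den_widen n m : (n <= m)%N ->
  den n = (p ^ n * \prod_(j < m) denfac j ^ (n %/ period j))%N.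
Proof.
move=> nm; rewrite /den; congr (_ * _)%N.
rewrite -!(big_mkord xpredT (fun j => denfac j ^ (n %/ period j))%N).
rewrite [RHS](@big_cat_nat _ _ _ n) //= (_ : \prod_(n <= i < m) _ = 1)%N ?muln1 //.
rewrite big_nat_cond big1 // => j; rewrite andbT => /andP[nj _].
by rewrite divn_small // (leq_ltn_trans nj) // period_gt.
Qed.

Lemma den_dvd n k : (den n * p ^ k %| den (n + k))%N.
Proof.
rewrite (den_widen (leq_addr k n)) /den mulnAC -expnD dvdn_mul //.
elim/big_ind2: _ => // [a b c d|j _]; first exact: dvdn_mul.
by rewrite dvdn_exp2l // leq_div2r // leq_addr.
Qed.

(** Over [period j] levels the exponent of [denfac j] rises by exactly one and no other exponent
    drops. *)
Lemma den_dvd_denfac n j : (den n * denfac j %| den (n + period j))%N.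
Proof.
rewrite (den_widen (leq_addr (period j) n)) /den expnD -!mulnA dvdn_mul //.
have jn : (j < n + period j)%N by rewrite (leq_trans (period_gt j)) // leq_addl.
rewrite dvdn_mull // (bigD1 (Ordinal jn)) //= [X in (_ %| X)%N](bigD1 (Ordinal jn)) //=.
rewrite mulnAC -expnSr dvdn_mul //.
  rewrite dvdn_exp2l // divnDr ?dvdnn // divnn.
  by rewrite (leq_ltn_trans _ (period_gt j)) // addn1.
elim/big_ind2: _ => // [a b c d|i _]; first exact: dvdn_mul.
by rewrite dvdn_exp2l // leq_div2r // leq_addr.
Qed.

(** The last quotient is counted twice because this stronger form is inductive:
    [2 * (a %/ 2) <= a]. *)
Lemma sum_div_exp2 n m : (\sum_(j < m.+1) n %/ 2 ^ j + n %/ 2 ^ m <= 2 * n)%N.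
Proof.
elim: m => [|m IH].
  by rewrite big_ord_recr big_ord0 /= expn0 divn1; lia.
apply: leq_trans IH; rewrite big_ord_recr /= -addnA leq_add2l.
by rewrite expnSr divnMA; lia.
Qed.

Lemma den_le n : (den n <= (4 * p) ^ n)%N.
Proof.
rewrite /den expnMn mulnC leq_mul2r (_ : 4 = 2 ^ 2)%N // -expnM; apply/orP; right.
(* As [denfac j <= 2 ^ j], the period [j.+1 * 2 ^ j] makes the [j]-th factor at most
   [2 ^ (n %/ 2 ^ j)]; the exponents sum to at most [2 * n]. *)
apply: leq_trans (_ : 2 ^ (\sum_(j < n) n %/ 2 ^ j) <= _)%N.
  rewrite expn_sum; apply: leq_prod => j _.
  apply: leq_trans (_ : (2 ^ j) ^ (n %/ period j) <= _)%N.
    have : (denfac j <= 2 ^ j)%N.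
      by rewrite /denfac; case: ifP; rewrite ?expn_gt0 // => _; exact: ltn_expl.
    by case: (n %/ period j)%N => // k; rewrite leq_exp2r.
  rewrite -expnM leq_exp2l // /period [(j.+1 * _)%N]mulnC divnMA.
  by apply: leq_trans (leq_divM _ j.+1); rewrite mulnC leq_mul2l leqnSn orbT.
rewrite leq_exp2l //; case: n => [|n]; first by rewrite big_ord0.
exact: leq_trans (leq_addr _ _) (sum_div_exp2 _ _).
Qed.

End Denominators.

(** * Distance to the lattice of multiples of [1 / b] *)

Section LatticeDistance.
Variable K : realType.
Implicit Types (b : nat) (v u : K).

(* The distance from [v] to the lattice of integer multiples of [1 / b]. *)
Definition ldist b v : K := `|v - (Num.floor (b%:R * v + 2^-1))%:~R / b%:R|.

Lemma ldist_attained b v : exists a : int, ldist b v = `|v - a%:~R / b%:R|.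
Proof. by eexists. Qed.

Lemma ldist_ge0 b v : 0 <= ldist b v.
Proof. exact: normr_ge0. Qed.

Lemma norm_sub_frac b v (a : int) : (0 < b)%N ->
  `|v - a%:~R / b%:R| = `|b%:R * v - a%:~R| / b%:R.
Proof.
move=> b0; have b0' : (b%:R : K) != 0 by rewrite pnatr_eq0 -lt0n.
have -> : b%:R * v - a%:~R = b%:R * (v - a%:~R / b%:R) by field.
by rewrite normrM ger0_norm // mulrAC divff // mul1r.
Qed.

(** The rounded integer is within 1/2 of [b * v], hence every other integer is at least 1/2 away. *)
Lemma ldist_le b v (a : int) : (0 < b)%N -> ldist b v <= `|v - a%:~R / b%:R|.
Proof.
move=> b0; rewrite /ldist !norm_sub_frac // ler_pM2r ?invr_gt0 ?ltr0n //.
set y := b%:R * v; set c := Num.floor _.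
have /andP[c1] := floor_itv (y + 2^-1); rewrite -/c intrD => c2.
have h : `|y - c%:~R| <= 2^-1 by rewrite ler_norml; lra.
have [->//|ac] := eqVneq a c; apply: le_trans h _.
have [lt|gt|/eqP] := ltgtP a c; last by rewrite (negPf ac).
- have : (a + 1)%:~R <= c%:~R :> K by rewrite ler_int; lia.
  by rewrite intrD ler_normr => h; apply/orP; left; lra.
- have : (c + 1)%:~R <= a%:~R :> K by rewrite ler_int; lia.
  by rewrite intrD ler_normr => h; apply/orP; right; lra.
Qed.

Lemma ldist_le_inv b v : (0 < b)%N -> ldist b v <= b%:R^-1.
Proof.
move=> b0; rewrite /ldist norm_sub_frac // ler_pdivrMr ?ltr0n //.
rewrite mulVf ?pnatr_eq0 -?lt0n //.
have /andP[c1] := floor_itv (b%:R * v + 2^-1); rewrite intrD => c2.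
by rewrite ler_norml; lra.
Qed.

Lemma ldist_le_norm b v : (0 < b)%N -> ldist b v <= `|v|.
Proof. by move=> b0; rewrite (le_trans (ldist_le v 0 b0)) // mul0r subr0. Qed.

Lemma ldistN b v : (0 < b)%N -> ldist b (- v) = ldist b v.
Proof.
move=> b0; suff le u : ldist b (- u) <= ldist b u.
  by apply/eqP; rewrite eq_le le -{1}(opprK v) le.
have [a ->] := ldist_attained b u; apply: le_trans (ldist_le _ (- a) b0) _.
by rewrite -[leLHS]normrN opprD !opprK intrN mulNr.
Qed.

Lemma ldistD b u v : (0 < b)%N -> ldist b (u + v) <= ldist b u + ldist b v.
Proof.
move=> b0; have [a ->] := ldist_attained b u; have [c ->] := ldist_attained b v.
apply: le_trans (ldist_le _ (a + c) b0) _; apply: le_trans (ler_normD _ _).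
by rewrite intrD mulrDl opprD addrACA.
Qed.

Lemma frac_dvd b b' (a : int) : (0 < b)%N -> (0 < b')%N -> (b %| b')%N ->
  a%:~R / b%:R = (a * (b' %/ b)%N%:Z)%:~R / b'%:R :> K.
Proof.
move=> b0 b'0 /dvdnP[k b'E]; rewrite b'E in b'0 *; rewrite mulnK // intrM natrM.
move: b'0; rewrite muln_gt0 => /andP[k0 _].
have kn : (k%:R : K) != 0 by rewrite pnatr_eq0 -lt0n.
have bn : (b%:R : K) != 0 by rewrite pnatr_eq0 -lt0n.
by rewrite -pmulrn; field; rewrite kn bn.
Qed.

Lemma ldist_dvd b b' v : (0 < b)%N -> (0 < b')%N -> (b %| b')%N ->
  ldist b' v <= ldist b v.
Proof.
move=> b0 b'0 bb'; have [a ->] := ldist_attained b v.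
by rewrite (frac_dvd a b0 b'0 bb') ldist_le.
Qed.

(** Translation by a point of the coarser lattice preserves the finer one. *)
Lemma ldistB_frac b b' v (a : int) : (0 < b)%N -> (0 < b')%N -> (b %| b')%N ->
  ldist b' (v - a%:~R / b%:R) <= ldist b' v.
Proof.
move=> b0 b'0 bb'; have [c ->] := ldist_attained b' v.
rewrite (frac_dvd a b0 b'0 bb') (le_trans (ldist_le _ (c - a * (b' %/ b)%N%:Z) b'0)) //.
by rewrite intrB mulrBl opprB addrA subrK.
Qed.

Lemma ldist_frac b b' (a : int) : (0 < b)%N -> (0 < b')%N -> (b %| b')%N ->
  ldist b' (a%:~R / b%:R) = 0.
Proof.
move=> b0 b'0 bb'; apply/eqP; rewrite eq_le ldist_ge0 andbT.
apply: le_trans (ldist_le _ (a * (b' %/ b)%N%:Z) b'0) _.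
by rewrite -frac_dvd // subrr normr0.
Qed.

(** Dividing a nearest point of the lattice of [1 / b] by [t] gives a point of the lattice of
    [1 / (b * t)], which that of [1 / b'] contains. *)
Lemma ldist_div b b' t v : (0 < b)%N -> (0 < b')%N -> (b * t %| b')%N ->
  ldist b' (v / t%:R) <= ldist b v.
Proof.
move=> b0 b'0 btb'; have bt0 : (0 < b * t)%N by apply: dvdn_gt0 btb'.
have t0 : (0 < t)%N by move: bt0; rewrite muln_gt0 => /andP[].
have [a ->] := ldist_attained b v.
apply: le_trans (ldist_dvd _ bt0 b'0 btb') _.
apply: le_trans (ldist_le _ a bt0) _.
have -> : v / t%:R - a%:~R / (b * t)%:R = (v - a%:~R / b%:R) / t%:R.
  by rewrite natrM invfM mulrA mulrBl.
rewrite normrM ler_piMr // ger0_norm ?invr_ge0 //.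
by rewrite invf_le1 ?ltr0n // ler1n.
Qed.

Lemma ldist_small b v : (0 < b)%N -> b%:R * `|v| <= 2^-1 -> ldist b v = `|v|.
Proof.
move=> b0 bv; apply/eqP; rewrite eq_le ldist_le_norm //=.
have [a ->] := ldist_attained b v; rewrite norm_sub_frac //.
rewrite ler_pdivlMr ?ltr0n // mulrC -[X in X * _](@ger0_norm _ b%:R) // -normrM.
move: bv; rewrite -[X in X * _](@ger0_norm _ b%:R) // -normrM.
set y := b%:R * v => hy.
(* A nonzero integer [a] has [|y - a| >= 1 - |y| >= 1/2], so 0 is nearest. *)
have [->|a0] := eqVneq a 0; first by rewrite subr0.
have : 1 <= `|a%:~R : K| by rewrite norm_intr_ge1 ?intr_int // intr_eq0.
have := ler_normB y (y - a%:~R); rewrite opprB addrCA subrr addr0; lra.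
Qed.

End LatticeDistance.

(** * The norms *)

Section SparseNorm.
Variables (K : realType) (p : nat) (S : pred nat).
Hypothesis p_gt1 : (1 < p)%N.

Local Notation den := (den p S).
Local Notation dgt0 := (den_gt0 S p_gt1).

(* An exponential rate strictly above the growth of [den]. *)
Definition rate : nat := (4 * p) ^ 2.

(** This is [b_(4^j) C^(m - 4^j)] with [C = rate], written as a quotient since the exponent is at
    most 0 in [layer]. *)
Definition weight j m : K := (den (4 ^ j) * rate ^ m)%:R / (rate ^ (4 ^ j))%:R.

Definition layer j (v : K) : K :=
  \sum_(0 <= m < (4 ^ j).+1) weight j m * ldist (den m) v.

Lemma rate_gt1 : (1 < rate)%N.
Proof. by rewrite /rate; nia. Qed.

Lemma rateX_gt0 n : 0 < (rate ^ n)%:R :> K.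
Proof. by rewrite ltr0n expn_gt0 (ltnW rate_gt1). Qed.

Lemma denR_gt0 n : 0 < (den n)%:R :> K.
Proof. by rewrite ltr0n dgt0. Qed.

Lemma weight_gt0 j m : 0 < weight j m.
Proof. by rewrite /weight natrM divr_gt0 ?mulr_gt0 ?rateX_gt0 ?denR_gt0. Qed.

Lemma weightD j m n : weight j (m + n) = (rate ^ n)%:R * weight j m.
Proof. by rewrite /weight expnD !natrM; ring. Qed.

Lemma layer_ge0 j v : 0 <= layer j v.
Proof.
by rewrite sumr_ge0 // => m _; rewrite mulr_ge0 ?ldist_ge0 // ltW ?weight_gt0.
Qed.

Lemma layer_mono j u v : (forall m, ldist (den m) u <= ldist (den m) v) ->
  layer j u <= layer j v.
Proof. by move=> uv; apply: ler_sum => m _; rewrite ler_pM2l ?weight_gt0. Qed.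

Lemma layerN j v : layer j (- v) = layer j v.
Proof. by apply: eq_bigr => m _; rewrite ldistN ?dgt0. Qed.

Lemma layerD j u v : layer j (u + v) <= layer j u + layer j v.
Proof.
rewrite -big_split; apply: ler_sum => m _ /=.
by rewrite -mulrDr ler_pM2l ?weight_gt0 // ldistD ?dgt0.
Qed.

Lemma layer_lipschitz j : exists2 L : K, 0 < L & forall v, layer j v <= L * `|v|.
Proof.
exists (\sum_(0 <= m < (4 ^ j).+1) weight j m).
  rewrite big_nat_recl //= ltr_wpDr ?weight_gt0 // sumr_ge0 // => m _.
  by rewrite ltW ?weight_gt0.
move=> v; rewrite mulr_suml; apply: ler_sum => m _.
by rewrite ler_pM2l ?weight_gt0 // ldist_le_norm ?dgt0.
Qed.

Lemma den_dvd_le m n : (m <= n)%N -> (den m %| den n)%N.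
Proof.
move=> /subnKC <-; apply: dvdn_trans (den_dvd p S m (n - m)).
exact: dvdn_mulr.
Qed.

Lemma leq_exp_base a c n : (a <= c)%N -> (a ^ n <= c ^ n)%N.
Proof. by case: n => // n ac; rewrite leq_exp2r. Qed.

Lemma den_exp2 m n : (m <= n)%N ->
  (2 ^ (n - m))%:R * (den m)%:R <= (den n)%:R :> K.
Proof.
move=> mn; rewrite -natrM ler_nat mulnC.
have := dvdn_leq (dgt0 _) (den_dvd p S m (n - m)); rewrite subnKC //.
by apply: leq_trans; rewrite leq_mul2l leq_exp_base ?orbT.
Qed.

(** Sparseness of the scales: in [layer_small] this gap pays for a factor [2 ^ (j + k)]. *)
Lemma pow4_gap j k : (k < j)%N -> (2 * 4 ^ k + (j + k) <= 4 ^ j)%N.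
Proof.
case: j => // j; rewrite ltnS expnS => kj.
have := @leq_pexp2l 4 k j isT kj; have := ltn_expl j (isT : (1 < 4)%N); lia.
Qed.

(** By [den_le], [den] takes up only half of the exponent [2 * 4 ^ j] of [4 * p]; the other half
    absorbs the two extra factors. *)
Lemma den_rate j k m : (k + m <= 4 ^ j)%N ->
  (den (4 ^ j) * (4 * p) ^ k * 2 ^ m <= rate ^ (4 ^ j))%N.
Proof.
move=> km; rewrite /rate -expnM mul2n -addnn expnD -mulnA leq_mul ?den_le //.
apply: leq_trans (_ : (4 * p) ^ (k + m) <= _)%N; last by rewrite leq_pexp2l //; lia.
by rewrite expnD leq_mul2l leq_exp_base ?orbT //; lia.
Qed.

Lemma weight0_le j : weight j 0 <= ((2 ^ j)%:R)^-1.
Proof.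
rewrite /weight expn0 muln1 ler_pdivrMr ?rateX_gt0 // ler_pdivlMl ?ltr0n ?expn_gt0 //.
rewrite -natrM ler_nat mulnC.
have := @den_rate j 0 j; rewrite expn0 muln1 add0n; apply.
by rewrite ltnW // ltn_expl.
Qed.

Lemma sum_rate n : (\sum_(0 <= m < n) rate ^ m <= rate ^ n)%N.
Proof.
elim: n => [|n IH]; first by rewrite big_geq.
rewrite big_nat_recr //= expnS.
by have := rate_gt1; nia.
Qed.

(* Levels below [period] contribute a multiple of [`|v|] that is summable in
   [j]; the other ones are shifted, at the price of a power of [rate]. *)
Lemma layer_div j i v : layer j (v / (denfac S i)%:R) <=
  (rate ^ period i)%:R * (layer j v + weight j 0 * `|v|).
Proof.
set w := period i; set N := (4 ^ j).+1.
have w0 m : 0 <= weight j m * ldist (den m) (v / (denfac S i)%:R).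
  by rewrite mulr_ge0 ?ldist_ge0 // ltW ?weight_gt0.
rewrite /layer -/N mulrDr addrC.
(* Extending the sum to [w + N] terms allows a split at [w] even when [w] exceeds [N]. *)
apply: le_trans (_ : \sum_(0 <= m < w + N)
    weight j m * ldist (den m) (v / (denfac S i)%:R) <= _).
  by rewrite [leRHS](@big_cat_nat _ _ _ N) //= ?leq_addl // lerDl sumr_ge0.
rewrite (@big_cat_nat _ _ _ w) //= ?leq_addr // lerD //.
  apply: le_trans (_ : \sum_(0 <= m < w) (rate ^ m)%:R * (weight j 0 * `|v|) <= _).
    apply: ler_sum => m _; rewrite -{1}[m]add0n weightD mulrA ler_pM2l.
      apply: le_trans (ldist_le_norm _ (dgt0 _)) _.
      rewrite normrM ler_piMr // normfV normr_nat invf_le1 ?ltr0n ?denfac_gt0 //.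
      by rewrite ler1n denfac_gt0.
    by rewrite mulr_gt0 ?rateX_gt0 ?weight_gt0.
  rewrite -mulr_suml ler_wpM2r ?mulr_ge0 ?(ltW (weight_gt0 _ _)) //.
  by rewrite -natr_sum ler_nat sum_rate.
rewrite -{1}[w]add0n big_addn addKn mulr_sumr; apply: ler_sum => m _.
rewrite weightD -mulrA ler_pM2l ?rateX_gt0 // ler_pM2l ?weight_gt0 //.
by apply: ldist_div; rewrite ?dgt0 // den_dvd_denfac.
Qed.

Lemma sum_weight j n :
  \sum_(0 <= m < n) weight j m <= (den (4 ^ j) * rate ^ n)%:R / (rate ^ (4 ^ j))%:R.
Proof.
rewrite -mulr_suml ler_wpM2r ?invr_ge0 // -natr_sum ler_nat.
by rewrite -big_distrr leq_mul2l sum_rate orbT.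
Qed.

(** If [j < k], the vector is so short that its absolute value times the total weight suffices. If
    [k < j], it lies in all lattices from level [4 ^ k] on, and the weights below that level are
    tiny. *)
Lemma layer_small j k : j != k ->
  layer j (den (4 ^ k))%:R^-1 <= rate%:R / (2 ^ (j + k))%:R.
Proof.
have inv_ge0 n : 0 <= ((den n)%:R^-1 : K) by rewrite invr_ge0.
have dist_le m : ldist (den m) (den (4 ^ k))%:R^-1 <= ((den (4 ^ k))%:R^-1 : K).
  by rewrite -[leRHS]ger0_norm // ldist_le_norm ?dgt0.
rewrite neq_ltn => /orP[jk|kj].
  apply: le_trans (_ : (\sum_(0 <= m < (4 ^ j).+1) weight j m) / (den (4 ^ k))%:R <= _).
    by rewrite mulr_suml; apply: ler_sum => m _; rewrite ler_pM2l ?weight_gt0.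
  apply: le_trans (ler_wpM2r (inv_ge0 _) (sum_weight _ _)) _.
  rewrite expnSr mulnA natrM [_ * rate%:R]mulrC natrM mulrA mulfK ?gt_eqF ?rateX_gt0 //.
  rewrite -mulrA ler_pM2l ?ltr0n ?(ltnW rate_gt1) //.
  rewrite ler_pdivrMr ?denR_gt0 // ler_pdivlMl ?ltr0n ?expn_gt0 //.
  apply: le_trans (den_exp2 (_ : (4 ^ j <= 4 ^ k)%N)); last first.
    by rewrite leq_exp2l // ltnW.
  rewrite ler_pM2r ?denR_gt0 // ler_nat leq_exp2l //.
  by have := pow4_gap jk; lia.
have kj4 : (4 ^ k <= (4 ^ j).+1)%N by rewrite leqW // leq_exp2l // ltnW.
rewrite /layer (@big_cat_nat _ _ _ (4 ^ k)) //= [X in _ + X]big_nat_cond.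
rewrite [X in _ + X]big1 ?addr0; last first.
  move=> m; rewrite andbT => /andP[km _].
  by rewrite -[_^-1]mul1r -[1]/(1%:~R) ldist_frac ?mulr0 ?dgt0 // den_dvd_le.
apply: le_trans (_ : \sum_(0 <= m < 4 ^ k) weight j m <= _).
  apply: ler_sum => m _; rewrite ler_piMr ?(ltW (weight_gt0 _ _)) //.
  by rewrite (le_trans (dist_le _)) // invf_le1 ?denR_gt0 // ler1n dgt0.
apply: le_trans (sum_weight _ _) _.
apply: le_trans (_ : (2 ^ (j + k))%:R^-1 <= _); last first.
  by rewrite ler_peMl ?invr_ge0 // ler1n (ltnW rate_gt1).
rewrite ler_pdivrMr ?rateX_gt0 // ler_pdivlMl ?ltr0n ?expn_gt0 //.
rewrite -natrM ler_nat mulnC {1}/rate -expnM; apply: den_rate.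
by have := pow4_gap kj; lia.
Qed.

(** One term suffices: at level [4 ^ j - h] the vector is at most half the mesh, so its distance to
    the lattice is its absolute value. *)
Lemma layer_large j h c : (h <= 4 ^ j)%N -> 2 * `|c| <= (2 ^ h)%:R ->
  `|c| / (rate ^ h)%:R <= layer j ((den (4 ^ j))%:R^-1 * c).
Proof.
move=> hj ch; have mj : (4 ^ j - h < (4 ^ j).+1)%N by rewrite ltnS leq_subr.
rewrite /layer big_mkord (bigD1 (Ordinal mj)) //=.
rewrite -[leLHS]addr0 lerD //; last first.
  by rewrite sumr_ge0 // => m _; rewrite mulr_ge0 ?ldist_ge0 // ltW ?weight_gt0.
rewrite ldist_small ?dgt0 //; last first.
  have := den_exp2 (leq_subr h (4 ^ j)); rewrite subKn // => hd.
  rewrite normrM normfV normr_nat mulrCA mulrC -ler_pdivlMr ?invr_gt0 ?denR_gt0 //.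
  rewrite invrK; have := denR_gt0 (4 ^ j - h); have := normr_ge0 c.
  move: hd ch; move: (_%:R) => a; nra.
rewrite normrM normfV normr_nat /weight natrM.
have -> : (rate ^ 4 ^ j)%:R = (rate ^ (4 ^ j - h))%:R * (rate ^ h)%:R :> K.
  by rewrite -natrM -expnD subnK.
have := denR_gt0 (4 ^ j); have := rateX_gt0 (4 ^ j - h); have := rateX_gt0 h.
move: (_%:R) (_%:R) (_%:R) `|c| => x y z t x0 y0 z0.
by rewrite (_ : _ * (_ * t) = t / z) //; field; rewrite !gt_eqF.
Qed.

Definition sparse_norm (X : pred nat) n (v : K) : K :=
  `|v| + \sum_(0 <= j < n | ~~ X j) layer j v.

Variable X : pred nat.
Local Notation F := (sparse_norm X).

Lemma sparse_norm_ge n v : `|v| <= F n v.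
Proof. by rewrite lerDl sumr_ge0 // => j _; exact: layer_ge0. Qed.

Lemma sparse_normN n v : F n (- v) = F n v.
Proof.
rewrite /sparse_norm normrN; congr (_ + _).
by apply: eq_bigr => j _; exact: layerN.
Qed.

Lemma sparse_normD n u v : F n (u + v) <= F n u + F n v.
Proof.
rewrite /sparse_norm addrACA lerD ?ler_normD // -big_split.
by apply: ler_sum => j _; exact: layerD.
Qed.

Lemma sparse_norm_lipschitz n :
  exists2 L : K, 0 < L & forall v, F n v <= L * `|v|.
Proof.
elim: n => [|n [L L0 hL]].
  by exists 1 => // v; rewrite /sparse_norm big_geq // addr0 mul1r.
have [L' L'0 hL'] := layer_lipschitz n.
exists (L + L'); first exact: addr_gt0.
move=> v; rewrite /sparse_norm big_mkcond big_nat_recr //= -big_mkcond addrA mulrDl.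
by rewrite lerD ?hL //; case: ifP => // _; rewrite mulr_ge0 // ltW.
Qed.

Lemma sparse_norm1 n : F n 1 = 1.
Proof.
rewrite /sparse_norm normr1 big1 ?addr0 // => j _; rewrite /layer big1 // => m _.
have <- : 1%:~R / 1%:R = 1 :> K by rewrite divr1.
by rewrite ldist_frac ?mulr0 ?dgt0 // dvd1n.
Qed.

Lemma sparse_norm_cat m n v : (m <= n)%N ->
  F n v = F m v + \sum_(m <= j < n | ~~ X j) layer j v.
Proof. by move=> mn; rewrite /sparse_norm (@big_cat_nat _ _ _ m) //= addrA. Qed.

Lemma sparse_norm_mono m n v : (m <= n)%N -> F m v <= F n v.
Proof.
move=> mn; rewrite (sparse_norm_cat v mn) lerDl sumr_ge0 // => j _.
exact: layer_ge0.
Qed.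

Lemma sum_half n : \sum_(0 <= j < n) (2 ^ j)%:R^-1 <= 2 :> K.
Proof.
suff h : \sum_(0 <= j < n) (2 ^ j)%:R^-1 + (2 ^ n)%:R^-1 * 2 <= 2 :> K.
  by apply: le_trans h; rewrite lerDl mulr_ge0 // invr_ge0.
elim: n => [|n]; first by rewrite big_geq // expn0 invr1; lra.
rewrite big_nat_recr //= expnS natrM invfM; set a := _^-1; set b := \sum_(_ <= _ < _) _.
by lra.
Qed.

(** When [layer_div] is summed over the scales, the error terms total at most [2 * |v|] up to the
    power of [rate], by [weight0_le]; one more [|v|] from the first summand explains the 3. *)
Lemma sparse_norm_div n i v :
  F n (v / (denfac S i)%:R) <= 3 * (rate ^ period i)%:R * F n v.
Proof.
set c := (rate ^ period i)%:R.
have c1 : 1 <= c :> K by rewrite ler1n expn_gt0 (ltnW rate_gt1).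
have v1 : `|v / (denfac S i)%:R| <= `|v|.
  rewrite normrM ler_piMr // normfV normr_nat invf_le1 ?ltr0n ?denfac_gt0 //.
  by rewrite ler1n denfac_gt0.
have s1 : \sum_(0 <= j < n | ~~ X j) layer j (v / (denfac S i)%:R) <=
    c * (\sum_(0 <= j < n | ~~ X j) layer j v) + c * (2 * `|v|).
  rewrite -mulrDr.
  apply: le_trans (_ : \sum_(0 <= j < n | ~~ X j)
      c * (layer j v + weight j 0 * `|v|) <= _).
    by apply: ler_sum => j _; exact: layer_div.
  rewrite -mulr_sumr ler_wpM2l ?(le_trans ler01 c1) // big_split lerD //= -mulr_suml.
  rewrite ler_wpM2r //; apply: le_trans (sum_half n).
  rewrite big_mkcond; apply: ler_sum => j _; case: ifP => _; first exact: weight0_le.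
  by rewrite invr_ge0.
have s2 : 0 <= \sum_(0 <= j < n | ~~ X j) layer j v.
  by rewrite sumr_ge0 // => j _; exact: layer_ge0.
rewrite /sparse_norm; move: (normr_ge0 v) v1 s1 s2 c1.
move: (\sum_(_ <= _ < _ | _) layer _ v) (\sum_(_ <= _ < _ | _) _) => s t; nra.
Qed.

Lemma sparse_norm_natmul n (k : nat) v : F n (k%:R * v) <= k%:R * F n v.
Proof.
elim: k => [|k IH].
  rewrite !mul0r; have [L _ /(_ 0)] := sparse_norm_lipschitz n.
  by rewrite normr0 mulr0.
rewrite -natr1 !mulrDl !mul1r.
by apply: le_trans (sparse_normD _ _ _) _; rewrite lerD.
Qed.

Lemma sparse_norm_dense v C : (forall n, F n v <= C) -> forall e : K, 0 < e ->
  exists M (a : int), forall n, F n (v - a%:~R / (den M)%:R) <= e.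
Proof.
move=> vC e e0; have supF : has_sup (range (F^~ v)).
  by split; [exists (F 0%N v), 0%N | exists C => _ [n _ <-]].
have e20 : 0 < e / 2 by rewrite divr_gt0.
(* [m] is chosen so that the layers of [v] from [m] on total at most [e / 2]. *)
have [_ [m _ <-] hm] := sup_adherent e20 supF.
have [L L0 hL] := sparse_norm_lipschitz m.
(* Fine enough that [L / den M <= e / 2], which bounds [F m d]. *)
pose M := (Num.truncn (L / (e / 2))).+1.
have [a va] := ldist_attained (den M) v.
exists M, a => n; set d := v - _.
have small : F m d <= e / 2.
  apply: le_trans (hL _) _; rewrite -va mulrC -ler_pdivlMr //.
  apply: le_trans (ldist_le_inv _ (dgt0 _)) _.
  rewrite -[leRHS]invf_div lef_pV2 ?posrE ?denR_gt0 ?divr_gt0 //.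
  apply: le_trans (ltW (truncnS_gt _)) _; rewrite -/M ler_nat.
  have := den_exp2 (leq0n M); rewrite -natrM ler_nat subn0; apply: leq_trans.
  by apply: leq_trans (leq_pmulr _ (dgt0 0)); rewrite ltnW // ltn_expl.
(* Up to level [M], [|d|] is the distance from [v] to a finer lattice; from [M] on, [d] and [v]
   differ by a lattice point. *)
have dv k : ldist (den k) d <= ldist (den k) v.
  have [kM|/ltnW Mk] := leqP k M; last by apply: ldistB_frac; rewrite ?dgt0 ?den_dvd_le.
  apply: le_trans (ldist_le_norm _ (dgt0 _)) _.
  by rewrite /d -va; apply: ldist_dvd; rewrite ?dgt0 ?den_dvd_le.
have [nm|/ltnW mn] := leqP n m.
  by apply: le_trans (sparse_norm_mono _ nm) _; lra.
have : F n v <= sup (range (F^~ v)).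
  by apply: ub_le_sup; [case: supF | exists n].
rewrite !(sparse_norm_cat _ mn).
have : \sum_(m <= j < n | ~~ X j) layer j d <= \sum_(m <= j < n | ~~ X j) layer j v.
  by apply: ler_sum => j _; exact: layer_mono.
by lra.
Qed.

(** As [k] is in [X], layer [k] is absent; the other layers are bounded through [layer_small] by a
    geometric series of ratio 1/2. *)
Lemma sparse_norm_small k n : X k ->
  F n (den (4 ^ k))%:R^-1 <= (1 + 2 * rate%:R) / (2 ^ k)%:R.
Proof.
move=> Xk; rewrite mulrDl mul1r /sparse_norm lerD //.
  rewrite ger0_norm ?invr_ge0 // lef_pV2 ?posrE ?denR_gt0 ?ltr0n ?expn_gt0 //.
  apply: le_trans (den_exp2 (leq0n _)); rewrite -natrM ler_nat subn0.
  apply: leq_trans (leq_pmulr _ (dgt0 0)).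
  by rewrite leq_exp2l // ltnW // ltn_expl.
apply: le_trans (_ : \sum_(0 <= j < n) (2 ^ j)%:R^-1 * (rate%:R / (2 ^ k)%:R) <= _).
  rewrite big_mkcond; apply: ler_sum => j _; case: ifP => [Xj|_]; last first.
    by rewrite mulr_ge0 ?divr_ge0 ?invr_ge0.
  apply: le_trans (layer_small _) _; first by apply: contraNneq Xj => ->.
  by rewrite expnD natrM invfM mulrCA mulrA.
rewrite -mulr_suml -mulrA ler_wpM2r ?sum_half // divr_ge0 //.
Qed.

End SparseNorm.

(** From [M] on, every layer counted for [Y] is counted for [X]; the first [M] layers together are
    bounded by [L * |v|]. *)
Lemma sparse_norm_le (K : realType) (p : nat) (S : pred nat) (X Y : pred nat) M :
  (1 < p)%N -> (forall j, X j -> ~~ Y j -> (j < M)%N) ->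
  exists2 c : K, 0 < c & forall n v, sparse_norm p S Y n v <= c * sparse_norm p S X n v.
Proof.
move=> p1 XY; have [L L0 hL] := sparse_norm_lipschitz K S p1 pred0 M.
exists (1 + L); first by rewrite addr_gt0.
have sub (Z W : pred nat) m n v : (forall j, (m <= j < n)%N -> ~~ Z j -> ~~ W j) ->
    \sum_(m <= j < n | ~~ Z j) layer p S j v <=
    \sum_(m <= j < n | ~~ W j) layer p S j v.
  move=> ZW; rewrite big_mkcond [leRHS]big_mkcond big_nat_cond [leRHS]big_nat_cond.
  apply: ler_sum => j; rewrite andbT => jn; case: ifP => [/(ZW _ jn)->//|_].
  by case: ifP => // _; exact: layer_ge0.
move=> n v; rewrite mulrDl mul1r.
suff : sparse_norm p S Y n v <= sparse_norm p S X n v + sparse_norm p S pred0 M v.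
  move/le_trans; apply; rewrite lerD2l; apply: le_trans (hL v) _.
  by rewrite ler_pM2l // sparse_norm_ge.
have Y0 m : sparse_norm p S Y m v <= sparse_norm p S pred0 m v.
  by rewrite /sparse_norm lerD2l sub.
have [nM|/ltnW Mn] := leqP n M.
  apply: le_trans (Y0 n) _; apply: le_trans (sparse_norm_mono S p1 pred0 v nM) _.
  by rewrite lerDr (le_trans (normr_ge0 v)) // sparse_norm_ge.
rewrite (sparse_norm_cat p S Y v Mn) (sparse_norm_cat p S X v Mn) addrC.
rewrite lerD // -[leLHS]add0r lerD //.
  by rewrite (le_trans (normr_ge0 v)) // sparse_norm_ge.
apply: sub => j /andP[Mj _]; apply: contra => Xj.
by apply: contraLR Mj => /(XY j Xj); rewrite -ltnNge.
Qed.

(** * The modules *)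

Section Subring.
Variables (A : {pred rat}) (R : subComPzRingType A).

Lemma subring_mem (r : R) q : val r = q -> q \in A.
Proof. by move=> <-; exact: valP. Qed.

Lemma subringM q s : q \in A -> s \in A -> q * s \in A.
Proof.
by move=> qA sA; apply: (@subring_mem (Sub q qA * Sub s sA)); rewrite rmorphM /= !SubK.
Qed.

Lemma subringD q s : q \in A -> s \in A -> q + s \in A.
Proof.
by move=> qA sA; apply: (@subring_mem (Sub q qA + Sub s sA)); rewrite raddfD /= !SubK.
Qed.

Lemma subring_int (a : int) : a%:~R \in A.
Proof. by apply: (@subring_mem a%:~R); rewrite rmorph_int. Qed.

(** True at 0 by the convention [0^-1 = 0]; [denfac] tests positive integers only. *)
Definition inverted (n : nat) : bool := (n%:R : rat)^-1 \in A.

Lemma invertedM m n : inverted m -> inverted n -> inverted (m * n).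
Proof. by rewrite /inverted natrM invfM; exact: subringM. Qed.

Lemma inverted1 : inverted 1.
Proof. by rewrite /inverted invr1; exact: (subring_int 1). Qed.

Lemma invertedX m n : inverted m -> inverted (m ^ n).
Proof.
move=> m1; elim: n => [|n IH]; first exact: inverted1.
by rewrite expnS invertedM.
Qed.

Lemma inverted_den p n : inverted p -> inverted (den p inverted n).
Proof.
move=> pA; rewrite /den invertedM ?invertedX //.
apply: (big_ind inverted) => [||j _]; first exact: inverted1.
  exact: invertedM.
by apply: invertedX; rewrite /denfac; case: ifP => // _; exact: inverted1.
Qed.

(* Bezout: if [u a + v d = 1] then [1 / d = u (a / d) + v]. *)
Lemma inverted_denq q : q \in A -> inverted `|denq q|.
Proof.
move=> qA; have /coprimezP[[u v] /= uv] : coprimez (numq q) (denq q).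
  exact: coprime_num_den.
rewrite /inverted pmulrn absz_denq.
have -> : (denq q)%:~R^-1 = u%:~R * q + v%:~R.
  rewrite -[X in _ * X]divq_num_den.
  have dn : (denq q)%:~R != 0 :> rat by rewrite intr_eq0 denq_neq0.
  apply: (mulIf dn); rewrite mulVf // mulrDl -mulrA divfK // -!intrM -intrD.
  by rewrite uv.
by rewrite subringD ?subringM ?subring_int.
Qed.

(** [A] contains the integers, so it has a fractional element; its denominator is the required
    [p]. *)
Lemma inverted_gt1 : ~ (forall q : rat, (q \in A) = (q \is a Num.int)) ->
  exists2 p, (1 < p)%N & inverted p.
Proof.
move=> /existsNP[q qA]; exists `|denq q|%N; last first.
  apply: inverted_denq; case qA' : (q \in A) => //.
  case: qA; rewrite qA'; apply/esym/negP => /intrP[a qa].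
  by move: qA'; rewrite qa subring_int.
have d0 := denq_gt0 q.
have : denq q != 1.
  apply/eqP => d1; apply: qA; have : q \is a Num.int by rewrite Qint_def d1.
  by move=> qi; rewrite qi; move: qi => /intrP[a ->]; rewrite subring_int.
by lia.
Qed.

Section SparseModule.
Variables (K : realType) (p : nat).
Hypotheses (p_gt1 : (1 < p)%N) (pA : inverted p).
Implicit Types X Y : pred nat.

Lemma sparse_norm_scale X (r : R) : exists2 c : K, 0 < c & forall n v,
  sparse_norm p inverted X n (ratr (val r) * v) <= c * sparse_norm p inverted X n v.
Proof.
set q := val r; set d := `|denq q|%N.
have d0 : (0 < d)%N by rewrite absz_gt0 denq_neq0.
have dA : inverted d by apply: inverted_denq; exact: valP.
set s : K := 3 * (rate p ^ period d.-1)%:R.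
have s0 : 0 < s by rewrite mulr_gt0 ?rateX_gt0.
(* The successor keeps the constant positive when [r] is 0. *)
exists ((`|numq q|.+1)%:R * s); first by rewrite mulr_gt0 ?ltr0n.
move=> n v.
have := @sparse_norm_div K p inverted p_gt1 X n d.-1 v.
have -> : denfac inverted d.-1 = d by rewrite /denfac prednK ?dA.
rewrite -/s => hs.
have vE : ratr q * v = (numq q)%:~R * (v / d%:R).
  by rewrite /ratr mulrAC mulrA -[d%:R]/(d%:Z%:~R) absz_denq.
have F0 : 0 <= sparse_norm p inverted X n v.
  by rewrite (le_trans (normr_ge0 v)) // sparse_norm_ge.
apply: le_trans (_ : `|numq q|%:R * sparse_norm p inverted X n (v / d%:R) <= _).
  rewrite vE; case: (numq q) => k.
    exact: sparse_norm_natmul.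
  by rewrite NegzE intrN mulNr sparse_normN // abszN; exact: sparse_norm_natmul.
rewrite -mulrA; apply: ler_pM => //.
  exact: le_trans (normr_ge0 _) (sparse_norm_ge _ _ _ _ _).
by rewrite ler_nat.
Qed.

Definition sparse_lscNorm X : @lscNorm K A R.
Proof.
refine (@LscNorm K A R (sparse_norm p inverted X) _ _ _ _ (sparse_norm_scale X) _).
- exact: sparse_normN.
- exact: sparse_normD.
- exact: sparse_norm_ge.
- exact: sparse_norm_lipschitz.
- move=> v C vC e e0; have [M [a h]] := sparse_norm_dense p_gt1 vC e0.
  have rA : a%:~R / (den p inverted M)%:R \in A.
    by rewrite subringM ?subring_int //; exact: inverted_den.
  exists (Sub (a%:~R / (den p inverted M)%:R) rA) => n.
  by rewrite SubK fmorph_div rmorph_int rmorph_nat.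
Defined.

Definition sparse_module X : polishModule K R := normable_module (sparse_lscNorm X).

Lemma exp2_small (a e : K) N : 0 < e -> exists k0, forall k, (k0 <= k)%N ->
  a / (2 ^ k)%:R <= e /\ (N <= k)%N.
Proof.
move=> e0; exists (maxn N (Num.truncn (`|a| / e)).+1) => k.
rewrite geq_max => /andP[-> ak].
split=> //; rewrite ler_pdivrMr ?ltr0n ?expn_gt0 // mulrC -ler_pdivrMr //.
apply: le_trans (_ : k%:R <= _); last by rewrite ler_nat ltnW // ltn_expl.
apply: le_trans (_ : (Num.truncn (`|a| / e)).+1%:R <= _); last by rewrite ler_nat.
by apply: le_trans (ltW (truncnS_gt _)); rewrite ler_pM2r ?invr_gt0 // ler_norm.
Qed.

Lemma sparse_module_uncountable X : (forall N, exists2 k, (N <= k)%N & X k) ->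
  ~ countable [set: sparse_module X].
Proof.
move=> infX; apply: normable_uncountable => e e0.
have [k0 hk] := exp2_small (1 + 2 * (rate p)%:R) 0 e0.
have [k k0k Xk] := infX k0.
exists (den p inverted (4 ^ k))%:R^-1.
  by rewrite invr_gt0 denR_gt0.
move=> n; apply: le_trans (sparse_norm_small K inverted p_gt1 n Xk) _.
by have [] := hk k k0k.
Qed.

Lemma sparse_module_embedding X Y : (exists M, forall j, X j -> ~~ Y j -> (j < M)%N) ->
  exists g : {linear sparse_module X -> sparse_module Y},
    [/\ continuous g, injective g & @normable_incl K A R (sparse_lscNorm X) =1
        @normable_incl K A R (sparse_lscNorm Y) \o g].
Proof.
move=> [M XY]; have [c c0 h] := sparse_norm_le K inverted p_gt1 XY.
exact: (@normable_le_embedding K A R (sparse_lscNorm X) (sparse_lscNorm Y) c c0 h).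
Qed.

Lemma sparse_module_rigid X Y :
  (forall N, exists2 k, (N <= k)%N & X k && ~~ Y k) ->
  forall g : {linear sparse_module X -> sparse_module Y},
    continuous g -> forall v, g v = 0.
Proof.
move=> XY; apply: continuous_linear_eq0.
  by exists 1 => n; rewrite /= sparse_norm1.
(* [h] ensures [2 * |c| <= 2 ^ h] and depends on [c] alone, so the lower bound is the same for all
   scales [k]. *)
move=> c c0; pose h := (Num.truncn (2 * `|c|)).+1.
exists (`|c| / (rate p ^ h)%:R); first by rewrite divr_gt0 ?normr_gt0 ?rateX_gt0.
move=> e e0; have [k0 hk] := exp2_small (1 + 2 * (rate p)%:R) h e0.
(* At a scale in [X] but not in [Y], [1 / den (4 ^ k)] is short for [X], while layer [k] detects its
   multiple by [c] for [Y]. *)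
have [k k0k /andP[Xk Yk]] := XY k0; have [ke hk'] := hk k k0k.
exists (Sub (den p inverted (4 ^ k))%:R^-1 (inverted_den (4 ^ k) pA)).
rewrite SubK fmorphV rmorph_nat; split.
  move=> n; have small := sparse_norm_small K inverted p_gt1 n Xk.
  have small_e := le_trans small ke; exact small_e.
(* Index [k.+1] gives the first partial norm that contains layer [k]. *)
exists k.+1; rewrite /= /sparse_norm big_mkcond big_nat_recr //= Yk.
rewrite addrA; apply: le_trans (@layer_large K p inverted p_gt1 k h c _ _) _.
- by rewrite (leq_trans hk') // ltnW // ltn_expl.
- apply: le_trans (ltW (truncnS_gt _)) _.
  by rewrite ler_nat ltnW // ltn_expl.
rewrite lerDr addr_ge0 // sumr_ge0 // => j _; case: ifP => // _.
exact: layer_ge0.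
Qed.

End SparseModule.

End Subring.

(* The odd scales encode [x]; having all the even ones in the set makes every
   module non-discrete, hence uncountable. *)
Definition scales (x : set nat) : pred nat := fun k => ~~ odd k || (k./2 \in x).

(* [A] is the set of rationals underlying the subring [R]; the index set of
   the family is all of [nat], in bijection with {1, 2, 3, ...} *)
Theorem theorem1p1 (K : realType) (A : {pred rat}) (R : subComPzRingType A)
    (R_neq_Z : ~ (forall q : rat, (q \in A) = (q \is a Num.int))) :
  exists V : set nat -> polishModule K R,
    [/\ forall x, ~ countable [set: V x],
        forall x, exists f : {linear V x -> real_module K R},
          continuous f /\ injective f,
        forall x y, finite_set (x `\` y) ->
          exists g : {linear V x -> V y}, continuous g /\ injective g,
        forall x y, infinite_set (x `\` y) ->
          (forall g : {linear V x -> V y},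
             continuous g -> forall v, g v = 0) /\
          ~ (exists g : {linear V x -> V y}, continuous g /\ injective g)
      & exists f : forall x, {linear V x -> real_module K R},
        [/\ forall x, continuous (f x) /\ injective (f x),
            forall x y, finite_set (x `\` y) ->
              exists g : {linear V x -> V y},
                [/\ continuous g, injective g & f x =1 f y \o g]
          & forall x, Fsigma (range (f x) : set K)]].
Proof.
have [p p_gt1 pA] := inverted_gt1 R R_neq_Z.
pose V x := sparse_module R K p_gt1 pA (scales x).
pose f x : {linear V x -> real_module K R} :=
  @normable_incl K A R (sparse_lscNorm R K p_gt1 pA (scales x)).
have f_emb x : continuous (f x) /\ injective (f x).
  by split; [exact: normable_incl_continuous | exact: normable_incl_inj].
have V_unc x : ~ countable [set: V x].
  (* The even scale [N.*2] belongs to every [scales x]. *)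
  apply: sparse_module_uncountable => N; exists N.*2; first by rewrite -addnn leq_addr.
  by rewrite /scales odd_double.
have V_emb x y : finite_set (x `\` y) -> exists g : {linear V x -> V y},
    [/\ continuous g, injective g & f x =1 f y \o g].
  move=> xy; apply: sparse_module_embedding.
  (* An odd [j] with [j./2] in [s] is at most twice the maximum plus 1. *)
  have /finite_seqP[s sE] := xy; exists (\max_(i <- s) i).*2.+2 => j.
  rewrite /scales; case: (boolP (odd j)) => //= oj; move=> /set_mem xj yj.
  have js : j./2 \in s.
    suff : [set` s] j./2 by [].
    by rewrite -sE; split=> // yj'; move: yj; rewrite (mem_set yj').
  have := @leq_bigmax_seq _ s xpredT id j./2 js isT.
  by have := odd_double_half j; rewrite oj /=; lia.
have V_rigid x y : infinite_set (x `\` y) ->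
    forall g : {linear V x -> V y}, continuous g -> forall v, g v = 0.
  move=> xy; apply: sparse_module_rigid => N.
  have [i Ni [xi yi]] : exists2 i, (N <= i)%N & (x `\` y) i.
    apply: contrapT => h; apply: xy; apply: sub_finite_set (finite_II N) => i xyi /=.
    by rewrite ltnNge; apply/negP => Ni; apply: h; exists i.
  exists i.*2.+1; first by rewrite (leq_trans Ni) // -addnn -addnS leq_addr.
  by rewrite /scales /= odd_double /= uphalf_double mem_set // memNset.
exists V; split=> //.
- by move=> x; exists (f x).
- by move=> x y /V_emb[g [gc gi _]]; exists g.
- move=> x y xy; split; first exact: V_rigid.
  (* An injective zero map would make the uncountable [V x] countable. *)
  move=> [g [gc gi]]; apply: (V_unc x); have g0 := V_rigid x y xy g gc.
  apply/countable_injP; exists (fun=> 0%N) => u v _ _ _.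
  by apply: gi; rewrite !g0.
- by exists f; split=> // x; exact: normable_incl_Fsigma.
Qed.
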